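(* Let $A$ be a finite set with $q:=|A|\ge 2$ and let $n\ge 2$. For $2\le l\le n$ let $G_l$ be the subgroup of $\mathrm{Sym}(A^n)$ generated by all $l$-ary instructions. Then: (i) for any $n$, $G_n=\mathrm{Sym}(A^n)$; (ii) if $q=2$ (identifying $A$ with $\mathrm{GF}(2)$), then $G_2=\mathrm{Aff}(n,2)$ for all $n$, and $G_3=G_{n-1}=\mathrm{Alt}(A^n)$ for $n\ge 4$; (iii) if $n\ge 3$ and $q\ge 3$ is odd, then $G_2=G_{n-1}=\mathrm{Sym}(A^n)$; (iv) if $n\ge 3$ and $q\ge 4$ is even, then $G_2=G_{n-1}=\mathrm{Alt}(A^n)$.
   Context: Any $f\in\mathrm{Sym}(A^n)$ is written $f(x)=(f_1(x),\ldots,f_n(x))$ with coordinate functions $f_i:A^n\to A$; the $i$-th coordinate function is trivial if $f_i(x)=x_i$ for all $x$. An instruction is a permutation of $A^n$ with at most one nontrivial coordinate function (the identity counts as an instruction). A coordinate function $f_j$ is $l$-ary if it depends on at most $l$ of the variables, i.e. $f_j(x)=h(x_{k_1},\ldots,x_{k_l})$ for some $k_1,\ldots,k_l\in\{1,\ldots,n\}$ and some $h:A^l\to A$; an $l$-ary instruction is an instruction whose coordinate functions are all $l$-ary. $\mathrm{Aff}(n,2)$ denotes the affine group of $\mathrm{GF}(2)^n$ (maps $x\mapsto Mx+b$ with $M\in\mathrm{GL}(n,2)$, $b\in\mathrm{GF}(2)^n$). *)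

(* Defs.v *)
From mathcomp Require Import all_boot all_order all_algebra all_fingroup all_solvable.
Set Implicit Arguments. Unset Strict Implicit. Unset Printing Implicit Defensive.

(* A^n is represented as {ffun 'I_n -> A}; Sym(A^n) as {perm {ffun 'I_n -> A}}.
   The j-th coordinate function of f is  fun x => f x j. *)
Definition word (A : finType) (n : nat) := {ffun 'I_n -> A}.

Definition coord_lary (A : finType) (n l : nat) (f : {perm word A n}) (j : 'I_n) : bool :=
  [exists S : {set 'I_n}, (#|S| <= l) &&
     [forall x : word A n, forall y : word A n,
        [forall k in S, x k == y k] ==> (f x j == f y j)]].

Definition instruction (A : finType) (n : nat) (f : {perm word A n}) : bool :=
  [exists i : 'I_n, [forall j : 'I_n, (j != i) ==>
      [forall x : word A n, f x j == x j]]].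

Definition lary_instruction (A : finType) (n l : nat) (f : {perm word A n}) : bool :=
  instruction f && [forall j : 'I_n, coord_lary l f j].

Definition G (A : finType) (n l : nat) : {set {perm word A n}} :=
  <<[set f : {perm word A n} | lary_instruction l f]>>%g.

(* Aff(n,2), transported to A^n along a bijection e : A -> GF(2):
   maps x |-> x M + b (row-vector convention) with M invertible. *)
Definition Aff (A : finType) (n : nat) (e : A -> 'F_2) : {set {perm word A n}} :=
  [set f : {perm word A n} | [exists M : 'M['F_2]_n, exists b : 'rV['F_2]_n,
     (M \in unitmx)%R &&
     [forall x : word A n,
        ((\row_i e (f x i)) == (\row_i e (x i)) *m M + b)%R]]].

(* Main.v *)
Require Import Defs.
From mathcomp Require Import all_boot all_order all_algebra all_fingroup all_solvable.
Set Implicit Arguments. Unset Strict Implicit. Unset Printing Implicit Defensive.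

(** "Lying on a common 3-cycle of H" is an equivalence relation on the points,
    and if it is total then H contains the alternating group. As any two words
    are joined by changes of single coordinates, it is enough to find, for two
    words differing in one coordinate, a 3-cycle of [G_l] through both.

    For q >= 3, a 3-cycle of one coordinate controlled by one other coordinate
    is a 2-ary instruction; a 3-cycle is its own commutator with a suitable
    transposition, so commutators accumulate controls until all other
    coordinates are fixed. For q = 2, commutators of controlled flips
    accumulate controls as long as one coordinate is left over, which yields
    products of two transpositions on coordinate squares; two such squares
    with just one common corner have a 3-cycle as commutator when n >= 4.

    An (n-1)-ary instruction ignores some coordinate, hence consists of q
    conjugate copies of one permutation: it is even when q is even. For odd q
    the same count shows that an uncontrolled transposition of one coordinate
    is odd. Finally, 2-ary instructions over GF(2) are affine, and row reduction
    by transvections shows that they generate the affine group. *)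

(** * Generating the alternating and symmetric groups from 3-cycles and transpositions *)

Section ThreeCycles.
Local Open Scope group_scope.

(** Products act from left to right, so for distinct points this is x -> y -> z -> x. *)
Definition cycle3 (T : finType) (x y z : T) : {perm T} := tperm x y * tperm x z.

Lemma cycle3J (T : finType) (x y z : T) (s : {perm T}) :
  cycle3 x y z ^ s = cycle3 (s x) (s y) (s z).
Proof. by rewrite /cycle3 conjMg !tpermJ. Qed.

Lemma cycle3V (T : finType) (x y z : T) : (cycle3 x y z)^-1 = cycle3 x z y.
Proof. by rewrite /cycle3 invMg !tpermV. Qed.

Lemma cycle3_1 (T : finType) (x y z : T) : x != y -> y != z -> cycle3 x y z x = y.
Proof. by move=> xy yz; rewrite /cycle3 permM tpermL tpermD // eq_sym. Qed.

Lemma cycle3_2 (T : finType) (x y z : T) : cycle3 x y z y = z.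
Proof. by rewrite /cycle3 permM tpermR tpermL. Qed.

Lemma cycle3_3 (T : finType) (x y z : T) : x != z -> y != z -> cycle3 x y z z = x.
Proof. by move=> xz yz; rewrite /cycle3 permM (tpermD xz yz) tpermR. Qed.

Lemma cycle3D (T : finType) (x y z t : T) :
  t != x -> t != y -> t != z -> cycle3 x y z t = t.
Proof.
by move=> tx ty tz; rewrite /cycle3 permM tpermD 1?eq_sym // tpermD // eq_sym.
Qed.

Lemma cycle3_rot (T : finType) (x y z : T) :
  x != y -> x != z -> y != z -> cycle3 x y z = cycle3 y z x.
Proof.
move=> xy xz yz; apply/permP=> t.
have [->|tx] := eqVneq t x; first by rewrite cycle3_1 // cycle3_3 1?eq_sym.
have [->|ty] := eqVneq t y; first by rewrite cycle3_2 cycle3_1 // eq_sym.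
have [->|tz] := eqVneq t z; first by rewrite cycle3_3 // cycle3_2.
by rewrite !cycle3D.
Qed.

Definition cycle3_linked (T : finType) (H : {set {perm T}}) (x y : T) : Prop :=
  x = y \/ exists z, [/\ x != y, x != z, y != z & cycle3 x y z \in H].

(** Conjugating (x y z) by (y w v) fixes [x] and moves [y] to [w], provided [x] differs from [w] and
    [v]. If [x = v], the inverse of (y w v) already links [x] to [w]. *)
Lemma cycle3_linked_trans (T : finType) (H : {group {perm T}}) (x y w : T) :
  cycle3_linked H x y -> cycle3_linked H y w -> cycle3_linked H x w.
Proof.
case=> [->//|[z [xy xz yz Hxyz]]] [<-|[v [yw yv wv Hywv]]].
  by right; exists z.
have [->|xw] := eqVneq x w; first by left.
have [xv|xv] := eqVneq x v.
  subst v; right; exists y; split; rewrite // 1?eq_sym //.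
  by rewrite -groupV cycle3V (cycle3_rot xy).
right; exists (cycle3 y w v z); split=> //.
- by rewrite -{1}(@cycle3D _ y w v x) // (inj_eq perm_inj).
- by rewrite -{1}(@cycle3_1 _ y w v) // (inj_eq perm_inj).
have <- : cycle3 x y z ^ cycle3 y w v = cycle3 x w (cycle3 y w v z).
  by rewrite cycle3J cycle3D // cycle3_1.
by rewrite groupJ.
Qed.

(** Linking gives (x y u) and (u z w) in [H]; conjugating the first by the second turns [u] into
    [z]. If [w] is [x] or [y], conjugating by the inverse of the second yields the inverse of the
    wanted 3-cycle. *)
Lemma all_cycle3_of_linked (T : finType) (H : {group {perm T}}) :
  (forall x y, cycle3_linked H x y) ->
  forall x y z, x != y -> x != z -> y != z -> cycle3 x y z \in H.
Proof.
move=> linkH x y z xy xz yz.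
have [/eqP|[u [_ xu yu Hxyu]]] := linkH x y; first by rewrite (negPf xy).
have [<-//|uz] := eqVneq u z.
have [/eqP|[w [_ uw zw Huzw]]] := linkH u z; first by rewrite (negPf uz).
rewrite eq_sym in xu; rewrite eq_sym in yu.
have [wx|wx] := eqVneq w x.
  subst w; rewrite -groupV cycle3V (cycle3_rot xz) // 1?eq_sym //.
  have <- : cycle3 x y u ^ (cycle3 u z x)^-1 = cycle3 z y x.
    by rewrite cycle3J cycle3V cycle3_2 cycle3D // ?cycle3_1 // eq_sym.
  by rewrite groupJ // groupV.
have [wy|wy] := eqVneq w y.
  subst w; rewrite -groupV cycle3V.
  have <- : cycle3 x y u ^ (cycle3 u z y)^-1 = cycle3 x z y.
    by rewrite cycle3J cycle3V cycle3_2 cycle3D // ?cycle3_1 // eq_sym.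
  by rewrite groupJ // groupV.
have <- : cycle3 x y u ^ (cycle3 u z w) = cycle3 x y z.
  by rewrite cycle3J cycle3_1 // !cycle3D // eq_sym.
by rewrite groupJ.
Qed.

(** An even permutation is a product of pairs of transpositions. A pair sharing a point is a 3-cycle
    or trivial; for other pairs, inserting (a c)(a c) in the middle gives two pairs that share a
    point. *)
Lemma Alt_sub_of_linked (T : finType) (H : {group {perm T}}) :
  (forall x y, cycle3_linked H x y) -> 'Alt_T \subset H.
Proof.
move=> linkH; have H3 := all_cycle3_of_linked linkH.
have Hshare a b c : a != b -> a != c -> tperm a b * tperm a c \in H.
  move=> ab ac; have [->|bc] := eqVneq b c; last exact: H3.
  by rewrite tperm2 group1.
have H2 a b c d : a != b -> c != d -> tperm a b * tperm c d \in H.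
  move=> ab cd; have [ac|ac] := eqVneq a c; first by subst c; exact: Hshare.
  have -> : tperm a b * tperm c d =
      (tperm a b * tperm a c) * (tperm c a * tperm c d).
    by rewrite (tpermC c a) -mulgA tpermKg.
  by rewrite groupM // Hshare // eq_sym.
apply/subsetP=> s; rewrite Alt_even.
have [ts -> dts] := prod_tpermP s.
rewrite odd_perm_prod //.
have [m] := ubnP (size ts); elim: m ts dts => // m IHm [|t1 [|t2 ts]] //=.
  by rewrite big_nil group1.
case/and3P=> d1 d2 dts; rewrite negbK => szm ev.
by rewrite !big_cons mulgA groupM ?H2 // IHm // -ltnS ltnW.
Qed.

Lemma Sym_sub_of_tperm (T : finType) (H : {group {perm T}}) :
  (forall x y, tperm x y \in H) -> 'Sym_T \subset H.
Proof.
move=> HT; apply/subsetP=> s _; have [ts -> _] := prod_tpermP s.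
by apply: group_prod=> t _; apply: HT.
Qed.

(* With [f] and [g] meeting in the single point [p], everything away from
   [p], [f p], [g p] cancels in the commutator [f g f g]. *)
Lemma commutator_meeting_once (T : finType) (f g : {perm T}) (p : T) :
  involutive f -> involutive g -> f p != p -> g p != p ->
  (forall x, x != p -> f x = x \/ g x = x) ->
  (f * g) * (f * g) = cycle3 p (g p) (f p).
Proof.
move=> ff gg fp gp fg.
have gu : g (f p) = f p.
  by have [|//] := fg _ fp; rewrite ff => /eqP; rewrite eq_sym (negPf fp).
have fw : f (g p) = g p.
  by have [//|] := fg _ gp; rewrite gg => /eqP; rewrite eq_sym (negPf gp).
have uw : g p != f p.
  by apply: contra_neq gp => e; rewrite -fw e ff.
apply/permP=> x; rewrite (permM (f * g)) !(permM f g).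
have [->|xp] := eqVneq x p; first by rewrite gu ff cycle3_1 // eq_sym.
have [->|xu] := eqVneq x (f p).
  by rewrite ff fw gg cycle3_3 // eq_sym.
have [->|xw] := eqVneq x (g p); first by rewrite fw gg gu cycle3_2.
rewrite cycle3D //.
have gxp : g x != p by apply: contra_neq xw => <-; rewrite gg.
have fxp : f x != p by apply: contra_neq xu => <-; rewrite ff.
have [e|e] := fg _ xp.
  rewrite e; have [->|] := fg _ gxp; rewrite gg // => e2.
  by rewrite -e2 e -e2.
have [|->] := fg _ fxp; rewrite ff // => e2.
by rewrite -e2 e -e2 e.
Qed.
End ThreeCycles.

(** * Permutations of one coordinate controlled by others *)

Section ControlledPermutations.
Local Open Scope group_scope.

Definition upd (A : finType) (n : nat) (x : word A n) (i : 'I_n) (a : A) : word A n :=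
  [ffun j => if j == i then a else x j].

Lemma upd_same (A : finType) (n : nat) (x : word A n) i a : upd x i a i = a.
Proof. by rewrite ffunE eqxx. Qed.

Lemma upd_other (A : finType) (n : nat) (x : word A n) i a j :
  j != i -> upd x i a j = x j.
Proof. by rewrite ffunE => /negPf->. Qed.

Lemma upd_id (A : finType) (n : nat) (x : word A n) i : upd x i (x i) = x.
Proof. by apply/ffunP=> j; rewrite ffunE; case: eqP => [->|]. Qed.

Lemma upd_upd (A : finType) (n : nat) (x : word A n) i a b :
  upd (upd x i a) i b = upd x i b.
Proof. by apply/ffunP=> j; rewrite !ffunE; case: eqP. Qed.

Lemma updC (A : finType) (n : nat) (x : word A n) i j a b :
  i != j -> upd (upd x i a) j b = upd (upd x j b) i a.
Proof.
move=> ij; apply/ffunP=> k; rewrite !ffunE.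
by case: (eqVneq k i) => [->|//]; rewrite (negPf ij).
Qed.

(** The words [mix k] replace the coordinates of [x] by those of [y] one at a time. *)
Lemma word_rel_total (A : finType) (n : nat) (R : word A n -> word A n -> Prop) :
  (forall x, R x x) -> (forall x y z, R x y -> R y z -> R x z) ->
  (forall x i a, R x (upd x i a)) -> forall x y, R x y.
Proof.
move=> Rxx Rtr Rupd x y.
pose mix k : word A n := [ffun i : 'I_n => if i < k then y i else x i].
have Rmix k : k <= n -> R x (mix k).
  elim: k => [_|k IHk lekn].
    by have -> : mix 0 = x by apply/ffunP=> i; rewrite ffunE.
  apply: Rtr (IHk (ltnW lekn)) _.
  have -> : mix k.+1 = upd (mix k) (Ordinal lekn) (y (Ordinal lekn)).
    apply/ffunP=> i; rewrite !ffunE ltnS leq_eqVlt -val_eqE /=.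
    by case: eqP => //= e; congr (y _); apply: val_inj.
  exact: Rupd.
have <- : mix n = y by apply/ffunP=> i; rewrite ffunE ltn_ord.
exact: Rmix.
Qed.

Definition agree (A : finType) (n : nat) (S : {set 'I_n}) (x v : word A n) : bool :=
  [forall j in S, x j == v j].

Lemma agreeP (A : finType) (n : nat) (S : {set 'I_n}) (x v : word A n) :
  reflect {in S, x =1 v} (agree S x v).
Proof. exact: (iffP eqfun_inP). Qed.

Lemma agree_upd (A : finType) (n : nat) (S : {set 'I_n}) (x v : word A n) i a :
  i \notin S -> agree S (upd x i a) v = agree S x v.
Proof.
move=> iS; apply: eq_forallb_in => j jS; rewrite upd_other //.
by apply: contraNneq iS => <-.
Qed.

Lemma agreeU (A : finType) (n : nat) (S S' : {set 'I_n}) (x v : word A n) :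
  agree (S :|: S') x v = agree S x v && agree S' x v.
Proof.
apply/agreeP/andP => [H|[/agreeP H /agreeP H'] j].
  by split; apply/agreeP=> j jS; apply: H; rewrite inE jS ?orbT.
by case/setUP; [apply: H|apply: H'].
Qed.

Lemma agree1 (A : finType) (n : nat) (j : 'I_n) (x v : word A n) :
  agree [set j] x v = (x j == v j).
Proof.
apply/agreeP/eqP => [H|H k /set1P-> //]; exact: (H _ (set11 j)).
Qed.

(** Removing the target [i] from the controls makes the map bijective for every [S], so [ctl] needs
    no side condition. For a flip of two letters this is a generalized Toffoli gate. *)
Definition ctl_fun (A : finType) (n : nat) (i : 'I_n) (s : {perm A})
    (S : {set 'I_n}) (v x : word A n) : word A n :=
  if agree (S :\ i) x v then upd x i (s (x i)) else x.

Lemma ctl_funK (A : finType) (n : nat) (i : 'I_n) (s t : {perm A})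
    (S : {set 'I_n}) (v x : word A n) :
  ctl_fun i t S v (ctl_fun i s S v x) = ctl_fun i (s * t) S v x.
Proof.
rewrite /ctl_fun; case: (boolP (agree (S :\ i) x v)) => agr; last by rewrite (negPf agr).
by rewrite agree_upd ?setD11 // agr upd_same upd_upd permM.
Qed.

Lemma ctl_fun_inj (A : finType) (n : nat) (i : 'I_n) (s : {perm A})
    (S : {set 'I_n}) (v : word A n) : injective (ctl_fun i s S v).
Proof.
apply: (can_inj (g := ctl_fun i s^-1 S v)) => x.
by rewrite ctl_funK mulgV /ctl_fun perm1 upd_id if_same.
Qed.

Definition ctl (A : finType) (n : nat) (i : 'I_n) (s : {perm A})
    (S : {set 'I_n}) (v : word A n) : {perm word A n} :=
  perm (@ctl_fun_inj A n i s S v).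

Lemma ctlE (A : finType) (n : nat) (i : 'I_n) (s : {perm A})
    (S : {set 'I_n}) (v x : word A n) : i \notin S ->
  ctl i s S v x = if agree S x v then upd x i (s (x i)) else x.
Proof.
move=> iS; rewrite permE /ctl_fun; congr (if agree _ _ _ then _ else _).
by apply/setDidPl; rewrite disjoint_sym disjoints1.
Qed.

Lemma ctlM (A : finType) (n : nat) (i : 'I_n) (s t : {perm A})
    (S : {set 'I_n}) (v : word A n) :
  ctl i (s * t) S v = ctl i s S v * ctl i t S v.
Proof. by apply/permP=> x; rewrite permM !permE ctl_funK. Qed.

Lemma ctl1 (A : finType) (n : nat) (i : 'I_n) (S : {set 'I_n}) (v : word A n) :
  ctl i 1 S v = 1.
Proof. by apply/permP=> x; rewrite !permE /ctl_fun perm1 upd_id if_same. Qed.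

Lemma ctlV (A : finType) (n : nat) (i : 'I_n) (s : {perm A})
    (S : {set 'I_n}) (v : word A n) : ctl i s^-1 S v = (ctl i s S v)^-1.
Proof. by apply/eqP; rewrite eq_sym eq_invg_mul -ctlM mulgV ctl1. Qed.

(** Neither control condition reads the target, so both keep their truth value throughout; where at
    most one holds, each factor that fires meets its own inverse. *)
Lemma ctl_commutator (A : finType) (n : nat) (i : 'I_n) (s t : {perm A})
    (S S' : {set 'I_n}) (v : word A n) : i \notin S -> i \notin S' ->
  [~ ctl i s S v, ctl i t S' v] = ctl i [~ s, t] (S :|: S') v.
Proof.
move=> iS iS'; apply/permP=> x; rewrite !commgEl !conjgE -!ctlV !permM.
rewrite !ctlE ?inE ?negb_or ?iS // agreeU.
case: (boolP (agree S x v)) => aS; case: (boolP (agree S' x v)) => aS' /=.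
all: rewrite ?agree_upd // ?(negPf aS) ?(negPf aS') ?aS ?aS' ?upd_same ?upd_upd.
all: rewrite ?agree_upd // ?(negPf aS) ?(negPf aS') ?aS ?aS' ?upd_same ?upd_upd.
all: rewrite ?agree_upd // ?(negPf aS) ?(negPf aS') ?aS ?aS' ?upd_same ?upd_upd.
all: by rewrite -?permM ?mulgV ?mulVg ?perm1 ?upd_id.
Qed.

(** With every other coordinate as a control, only the line through [v] in direction [i] is
    affected. *)
Lemma ctl_tpermT (A : finType) (n : nat) (i : 'I_n) (a b : A) (v : word A n) :
  ctl i (tperm a b) [set~ i] v = tperm (upd v i a) (upd v i b).
Proof.
have iS : i \notin [set~ i] by rewrite !inE eqxx.
apply/permP=> x; rewrite ctlE //.
have updI c d : (upd v i c == upd v i d) = (c == d).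
  apply/eqP/eqP => [/ffunP/(_ i)|->//]; by rewrite !upd_same.
case: (boolP (agree _ x v)) => [/agreeP agr|nagr].
  have -> : x = upd v i (x i).
    apply/ffunP=> j; have [->|ji] := eqVneq j i; first by rewrite upd_same.
    by rewrite upd_other // agr // !inE.
  rewrite upd_same upd_upd.
  have [->|xa] := eqVneq (x i) a; first by rewrite !tpermL.
  have [->|xb] := eqVneq (x i) b; first by rewrite !tpermR.
  by rewrite !tpermD ?updI // eq_sym.
have neq c : upd v i c != x.
  apply: contraNneq nagr => <-; rewrite agree_upd //; exact/agreeP.
by rewrite tpermD.
Qed.

Lemma ctl_cycle3T (A : finType) (n : nat) (i : 'I_n) (a b c : A) (v : word A n) :
  ctl i (cycle3 a b c) [set~ i] v = cycle3 (upd v i a) (upd v i b) (upd v i c).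
Proof. by rewrite ctlM !ctl_tpermT. Qed.

(** The inequality is strict because the new value of the target depends on the target as well as on
    the controls. *)
Lemma ctl_in_G (A : finType) (n l : nat) (i : 'I_n) (s : {perm A})
    (S : {set 'I_n}) (v : word A n) :
  i \notin S -> #|S| < l -> ctl i s S v \in G A n l.
Proof.
move=> iS Sl; apply: mem_gen; rewrite inE; apply/andP; split.
  apply/existsP; exists i; apply/forallP=> j; apply/implyP=> ji.
  apply/forallP=> x; rewrite ctlE //; case: ifP => // _.
  by rewrite upd_other.
apply/forallP=> j; apply/existsP.
have [->|ji] := eqVneq j i.
  exists (i |: S); rewrite cardsU1 iS add1n Sl /=.
  apply/forallP=> x; apply/forallP=> y; apply/implyP=> /eqfun_inP xy.
  rewrite !ctlE // (_ : agree S x v = agree S y v).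
    by case: ifP => _; rewrite ?upd_same xy // setU11.
  by apply: eq_forallb_in => k kS; rewrite xy // inE kS orbT.
exists [set j]; rewrite cards1 (leq_ltn_trans _ Sl) //=.
apply/forallP=> x; apply/forallP=> y; apply/implyP=> /eqfun_inP xy.
by rewrite !ctlE //; do 2![case: ifP => _]; rewrite ?upd_other ?xy ?set11.
Qed.

Lemma G_mono (A : finType) (n l m : nat) : l <= m -> G A n l \subset G A n m.
Proof.
move=> lm; apply: genS; apply/subsetP=> f; rewrite !inE /lary_instruction => /andP[-> /forallP H] /=.
apply/forallP=> j; have /existsP[S /andP[Sl HS]] := H j.
by apply/existsP; exists S; rewrite HS (leq_trans Sl lm).
Qed.

(** Having a transposition in the group is a transitive relation, by conjugation, and a
    transposition of two words that differ in one coordinate is itself an instruction. *)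
Lemma Gn_Sym (A : finType) (n : nat) : 'Sym_(word A n) \subset G A n n.
Proof.
apply: Sym_sub_of_tperm.
apply: word_rel_total => [x|x y z xy yz|x i a].
- by rewrite tperm1 group1.
- have [->|zx] := eqVneq x z; first by rewrite tperm1 group1.
  have [<-//|yx] := eqVneq y x; have [<-//|zy] := eqVneq y z.
  rewrite -(_ : tperm x y ^ tperm y z = tperm x z) ?groupJ //.
  by rewrite tpermJ tpermL tpermD // eq_sym.
rewrite -{1}(upd_id x i) -ctl_tpermT ctl_in_G ?inE ?eqxx //.
by rewrite cardsC1 card_ord prednK // (leq_ltn_trans _ (ltn_ord i)).
Qed.

(* A 3-cycle is its own commutator with a transposition inverting it, so
   controls can be added one at a time. *)
Lemma Alt_sub_G2 (A : finType) (n : nat) :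
  3 <= #|A| -> 'Alt_(word A n) \subset G A n 2.
Proof.
move=> cA; apply: Alt_sub_of_linked.
apply: word_rel_total => [x|x y z|x i b]; first by left.
  exact: cycle3_linked_trans.
set a := x i; have [ab|ab] := eqVneq a b.
  by left; rewrite -ab upd_id.
have [c cab] : exists c, c \notin [set a; b].
  apply/existsP; rewrite -negb_forall; apply/negP=> /forallP H.
  suff : #|A| <= 2 by rewrite leqNgt cA.
  rewrite -cardsT (leq_trans (subset_leq_card _) (_ : #|[set a; b]| <= 2)) //.
    by apply/subsetP=> c _; apply: H.
  by rewrite cards2; case: (a != b).
have [ca cb] : c != a /\ c != b by apply/andP; rewrite -negb_or; rewrite !inE in cab.
rewrite eq_sym in ca; rewrite eq_sym in cb.
right; exists (upd x i c).
have updI d e : (upd x i d == upd x i e) = (d == e).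
  by apply/eqP/eqP => [/ffunP/(_ i)|->//]; rewrite !upd_same.
have xE : x = upd x i a by rewrite /a upd_id.
split; rewrite ?updI //; try by rewrite {1}xE updI.
rewrite {1}xE -ctl_cycle3T.
set s := cycle3 a b c; set t := tperm b c.
(* Here [s ^ t] is the inverse of [s], so the commutator is s^-2, which equals [s] because s^3 =
   1. *)
have st : [~ s, t] = s.
  rewrite commgEl cycle3J tpermL tpermR tpermD 1?eq_sym // -cycle3V -/s.
  apply/eqP; rewrite -invMg eq_invg_mul; apply/eqP/permP=> e.
  rewrite (permM (s * s)) (permM s) perm1.
  have [->|ea] := eqVneq e a; first by rewrite cycle3_1 // cycle3_2 cycle3_3.
  have [->|eb] := eqVneq e b; first by rewrite cycle3_2 cycle3_3 // cycle3_1.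
  have [->|ec] := eqVneq e c; first by rewrite cycle3_3 // cycle3_1 // cycle3_2.
  by rewrite !cycle3D.
have : i \notin [set~ i] by rewrite !inE eqxx.
have [m] := ubnP #|[set~ i]|; elim: m [set~ i] => // m IHm S Sm iS.
have [->|[j jS]] := set_0Vmem S; first by rewrite ctl_in_G ?inE ?cards0.
have iS' : i \notin S :\ j by rewrite !inE negb_and iS orbT.
have ij : i \notin [set j] by rewrite inE; apply: contraNneq iS => ->.
(* The factor [s] keeps the controls [S :\ j], while [t] is controlled by [j] alone and is thus a
   2-ary instruction. *)
rewrite -(setD1K jS) setUC -st -ctl_commutator // groupR //.
  by apply: IHm => //; rewrite (cardsD1 j) jS in Sm.
by rewrite ctl_in_G // cards1.
Qed.
End ControlledPermutations.

(** * Signs of instructions that ignore a coordinate *)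

Section Parity.
Local Open Scope group_scope.

Lemma exists_notin (T : finType) (S : {set T}) : #|S| < #|T| -> exists k, k \notin S.
Proof.
move=> cS; apply/existsP; rewrite -negb_forall; apply: contraL cS => /forallP H.
by rewrite -leqNgt -cardsT subset_leq_card //; apply/subsetP=> k _; apply: H.
Qed.

(** [f] is the product of its restrictions to the slices on which coordinate [k] is constant. These
    are conjugate, so their signs agree and only the parity of their number matters. *)
Lemma odd_perm_ignoring (A : finType) (n : nat) (f : {perm word A n}) (k : 'I_n) (a : A) :
  (forall x, f x k = x k) -> (forall x c, f (upd x k c) = upd (f x) k c) ->
  odd_perm f = odd #|A| && odd_perm (restr_perm [set x : word A n | x k == a] f).
Proof.
move=> fk fupd.
pose F (B : {set A}) := restr_perm [set x : word A n | x k \in B] f.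
have FE B x : F B x = if x k \in B then f x else x.
  have fN : f \in 'N([set x : word A n | x k \in B] | 'P).
    by apply/astabsP=> y; rewrite !inE /= apermE fk.
  case: ifP => xB; first by rewrite restr_permE // inE.
  by rewrite (out_perm (restr_perm_on _ _)) // inE xB.
have FJ b : odd_perm (F [set b]) = odd_perm (F [set a]).
  (* Exchanging the letters [a] and [b] in coordinate [k] conjugates one slice to the other. The
     control set is empty, so the control word is arbitrary. *)
  pose w := ctl k (tperm a b) set0 [ffun=> a].
  have wE x : w x = upd x k (tperm a b (x k)).
    rewrite ctlE ?inE // (_ : agree _ _ _) //.
    by apply/agreeP=> j; rewrite inE.
  rewrite -(odd_permJ (F [set a]) w); congr (odd_perm _).
  rewrite conjgE -(mulKg w (F [set b])); congr (_ * _).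
  apply/permP=> x; rewrite !permM !FE !wE upd_same !inE.
  have [xa|xa] := eqVneq (x k) a.
    by rewrite xa tpermL eqxx fupd fk xa tpermL.
  case: ifP => // /eqP tb.
  by rewrite -(tpermK a b (x k)) tb tpermR eqxx in xa.
have FB B : odd_perm (F B) = odd #|B| && odd_perm (F [set a]).
  have [m] := ubnP #|B|; elim: m B => // m IHm B Bm.
  have [->|[c cB]] := set_0Vmem B.
    rewrite cards0 (_ : F set0 = 1) ?odd_perm1 //.
    by apply/permP=> x; rewrite FE inE perm1.
  have -> : F B = F [set c] * F (B :\ c).
    apply/permP=> x; rewrite permM !FE !inE.
    have [xc|xc] := eqVneq (x k) c; last by rewrite xc.
    by rewrite fk xc cB eqxx.
  rewrite (cardsD1 c) cB in Bm *.
  by rewrite odd_permM FJ (IHm (B :\ c)) //= add0n; case: (odd _); case: (odd_perm (F [set a])).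
have fE : f = F setT by apply/permP=> x; rewrite FE inE.
have -> : [set x : word A n | x k == a] = [set x : word A n | x k \in [set a]].
  by apply/setP=> x; rewrite !inE.
by rewrite [in LHS]fE FB cardsT.
Qed.

Lemma lary_instruction_even (A : finType) (n l : nat) (f : {perm word A n}) :
  2 <= #|A| -> ~~ odd #|A| -> l < n -> lary_instruction l f -> ~~ odd_perm f.
Proof.
move=> cA evA ln /andP[/existsP[i /forallP triv] /forallP/(_ i)/existsP[S /andP[Sl dep]]].
have trivE j x : j != i -> f x j = x j.
  by move=> ji; have /forallP/(_ x)/eqP := implyP (triv j) ji.
have depE (x y : word A n) : {in S, x =1 y} -> f x i = f y i.
  move=> xy; apply/eqP; have /forallP/(_ x)/forallP/(_ y)/implyP := dep.
  by apply; apply/eqfun_inP.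
have [|k kS] := @exists_notin _ S; first by rewrite card_ord (leq_ltn_trans Sl).
have depU x c : f (upd x k c) i = f x i.
  by apply: depE => j jS; rewrite upd_other //; apply: contraNneq kS => <-.
have /card_gt1P[a [b [_ _ ab]]] := cA.
(* If the ignored coordinate were the modified one, two words differing only there would have the
   same image. *)
have ki : k != i.
  apply: contraNneq ab => ki; subst k.
  have /perm_inj/ffunP/(_ i) : f (upd [ffun=> a] i a) = f (upd [ffun=> a] i b).
    apply/ffunP=> j; have [->|ji] := eqVneq j i; first by rewrite !depU.
    by rewrite !trivE // !upd_other.
  by rewrite !upd_same => ->.
rewrite (@odd_perm_ignoring _ _ f k a) ?(negPf evA) //.
  by move=> x; apply: trivE.
move=> x c; apply/ffunP=> j; have [->|ji] := eqVneq j i.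
  by rewrite depU upd_other // eq_sym.
by rewrite trivE // !ffunE trivE.
Qed.

Lemma G_sub_Alt (A : finType) (n l : nat) :
  2 <= #|A| -> ~~ odd #|A| -> l < n -> G A n l \subset 'Alt_(word A n).
Proof.
move=> cA evA ln; rewrite gen_subG; apply/subsetP=> f; rewrite inE Alt_even.
exact: lary_instruction_even.
Qed.

(** Induction on the number of coordinates outside [S]. Restricting to the slice through [v] adds a
    control and, [#|A|] being odd, keeps the sign; with full control the map is a single
    transposition. *)
Lemma ctl_tperm_odd (A : finType) (n : nat) (i : 'I_n) (a b : A)
    (S : {set 'I_n}) (v : word A n) :
  odd #|A| -> a != b -> i \notin S -> odd_perm (ctl i (tperm a b) S v).
Proof.
move=> oA ab; have [m] := ubnP #|~: S|; elim: m S => // m IHm S Sm iS.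
have [|] := boolP ([exists k, k \notin i |: S]).
  case/existsP=> k; rewrite !inE negb_or => /andP[ki kS].
  rewrite (@odd_perm_ignoring _ _ _ k (v k)).
  - rewrite oA /= (_ : restr_perm _ _ = ctl i (tperm a b) (k |: S) v).
      apply: IHm; last by rewrite !inE negb_or iS andbT eq_sym.
      rewrite -ltnS (leq_trans _ Sm) // ltnS.
      by rewrite (cardsD1 k (~: S)) inE kS setCU setDE setIC.
    have fN : ctl i (tperm a b) S v \in 'N([set x : word A n | x k == v k] | 'P).
      apply/astabsP=> y; rewrite !inE /= apermE ctlE //.
      by case: ifP => //; rewrite upd_other.
    apply/permP=> x; have [xk|xk] := boolP (x \in [set x : word A n | x k == v k]).
      rewrite restr_permE // !ctlE ?agreeU ?agree1 //.
        by move: xk; rewrite inE => ->.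
      by rewrite !inE negb_or iS andbT eq_sym.
    rewrite (out_perm (restr_perm_on _ _)) // ctlE ?agreeU ?agree1 //.
      by move: xk; rewrite inE => /negPf->.
    by rewrite !inE negb_or iS andbT eq_sym.
  - by move=> x; rewrite ctlE //; case: ifP => //; rewrite upd_other.
  move=> x c; rewrite !ctlE // agree_upd //; case: ifP => // _.
  by rewrite updC // upd_other // eq_sym.
rewrite negb_exists => /forallP full.
have -> : S = [set~ i].
  apply/setP=> k; rewrite !inE; have := full k; rewrite negbK !inE.
  by case: eqVneq => [->|//]; rewrite (negPf iS).
rewrite ctl_tpermT odd_tperm; apply: contraNneq ab => /ffunP/(_ i).
by rewrite !upd_same => ->.
Qed.

(** The alternating group is already there, so one odd element suffices: an uncontrolled
    transposition of the first coordinate. *)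
Lemma Sym_sub_G2 (A : finType) (n : nat) :
  3 <= #|A| -> odd #|A| -> 0 < n -> 'Sym_(word A n) \subset G A n 2.
Proof.
move=> cA oA n0; have /card_gt1P[a [b [_ _ ab]]] : 1 < #|A| by apply: ltnW.
pose t := ctl (Ordinal n0) (tperm a b) set0 [ffun=> a].
have tG : t \in G A n 2 by rewrite ctl_in_G ?inE ?cards0.
have ot : odd_perm t by rewrite ctl_tperm_odd ?inE.
apply/subsetP=> s _; have [os|es] := boolP (odd_perm s); last first.
  by rewrite (subsetP (Alt_sub_G2 n cA)) // Alt_even.
rewrite -(groupMr _ tG) (subsetP (Alt_sub_G2 n cA)) // Alt_even.
by rewrite odd_permM os ot.
Qed.
End Parity.

(** * Controlled flips over a two-letter alphabet *)

Section Binary.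
Local Open Scope group_scope.

(** The equation says at once that [s] has no fixed point and that [a] and [s a] are the only
    letters. *)
Lemma card2_flip (A : finType) : #|A| = 2 ->
  exists s : {perm A}, forall a b, (b == s a) = (b != a).
Proof.
move=> cA; have /cards2P[c [d [cd AE]]] : #|[set: A]| == 2 by rewrite cardsT cA.
exists (tperm c d) => a b.
have: a \in [set c; d] by rewrite -AE inE.
have: b \in [set c; d] by rewrite -AE inE.
have dc : d != c by rewrite eq_sym.
rewrite !inE => /orP[]/eqP-> /orP[]/eqP->;
  by rewrite ?tpermL ?tpermR ?eqxx ?(negPf cd) ?(negPf dc).
Qed.

(* [s] is the nontrivial permutation of a two-element alphabet: toggling
   coordinate [j] under the controls [S'] between two toggles of [i] makes
   exactly one of the two latter fire. *)
Lemma flip_commutator (A : finType) (n : nat) (s : {perm A}) (i j : 'I_n)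
    (S S' : {set 'I_n}) (v : word A n) :
  (forall a b, (b == s a) = (b != a)) -> i != j ->
  i \notin S -> j \notin S -> i \notin S' -> j \notin S' ->
  [~ ctl i s (j |: S) v, ctl j s S' v] = ctl i s (S :|: S') v.
Proof.
move=> sE ij iS jS iS' jS'.
have ss a : s (s a) = a by apply/eqP; rewrite eq_sym !sE eqxx.
have sV : s^-1 = s by apply/eqP; rewrite eq_invg_mul; apply/eqP/permP=> a; rewrite permM perm1.
have ji : j != i by rewrite eq_sym.
have iSj : i \notin j |: S by rewrite !inE negb_or ij.
apply/permP=> x; rewrite !commgEl !conjgE -!ctlV sV !permM.
have fE y : ctl i s (j |: S) v y =
    if (y j == v j) && agree S y v then upd y i (s (y i)) else y.
  by rewrite ctlE // agreeU agree1.
rewrite !fE !ctlE ?inE ?negb_or ?iS // agreeU.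
have sj : (s (x j) == v j) = (x j != v j) by rewrite eq_sym sE eq_sym.
case: (boolP (agree S x v)) => aS; case: (boolP (agree S' x v)) => aS';
  case: (boolP (x j == v j)) => xj /=.
all: do 6 ?[rewrite ?agree_upd // ?(negPf aS) ?(negPf aS') ?aS ?aS' /=
  ?upd_same ?(upd_other _ _ ij) ?(upd_other _ _ ji) ?upd_upd ?sj ?(negPf xj) ?xj /= ?ss].
all: by rewrite ?upd_id // ?(updC _ _ _ ij) ?upd_upd ?upd_id.
Qed.

(* A coordinate outside the controls and the target serves as a borrowed
   ancilla. *)
Lemma flip_in_G3 (A : finType) (n : nat) (s : {perm A}) (i : 'I_n)
    (S : {set 'I_n}) (v : word A n) :
  (forall a b, (b == s a) = (b != a)) -> i \notin S -> #|S|.+2 <= n ->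
  ctl i s S v \in G A n 3.
Proof.
move=> sE; have [m] := ubnP #|S|; elim: m i S => // m IHm i S Sm iS Sn.
have [S2|S2] := ltnP #|S| 3; first exact: ctl_in_G.
have [|j] := @exists_notin _ (i |: S); first by rewrite cardsU1 iS card_ord.
rewrite !inE negb_or => /andP[ji jS].
(* The pair [k], [l] will control the ancilla [j], a 3-ary instruction. The other factor keeps
   target [i] and has one control fewer than [S], with [j] among them. *)
have /card_gt1P[k [l [kS lS kl]]] : 1 < #|S| by apply: ltnW.
have lSk : l \in S :\ k by rewrite !inE lS eq_sym kl.
have -> : S = S :\ k :\ l :|: [set k; l].
  by rewrite [[set k; l]]setUC setUA [_ :|: [set l]]setUC (setD1K lSk) setUC setD1K.
have cS : #|S| = #|S :\ k :\ l|.+2.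
  by rewrite (cardsD1 k S) kS (cardsD1 l (S :\ k)) lSk.
have notin h : h \notin S -> (h \notin S :\ k :\ l) && (h \notin [set k; l]).
  move=> hS; rewrite !inE (negPf hS) !andbF /=; apply: contra hS.
  by case/orP=> /eqP->.
have /andP[iS1 iS2] := notin i iS; have /andP[jS1 jS2] := notin j jS.
have c1 : #|j |: (S :\ k :\ l)| = #|S|.-1 by rewrite cardsU1 jS1 cS.
rewrite -(flip_commutator v sE _ iS1 jS1 iS2 jS2) 1?eq_sym // groupR //.
  apply: IHm; rewrite ?c1 ?cS //=.
  - by rewrite cS in Sm; rewrite -ltnS.
  - by rewrite !inE negb_or eq_sym ji; move: iS1; rewrite !inE.
  by rewrite cS in Sn; apply: ltnW.
by rewrite ctl_in_G // cards2 kl.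
Qed.

(* Two products of two transpositions, each supported on a coordinate square,
   which meet in the corner [x] only; this needs four coordinates. *)
Lemma Alt_sub_G3 (A : finType) (n : nat) :
  #|A| = 2 -> 4 <= n -> 'Alt_(word A n) \subset G A n 3.
Proof.
move=> /card2_flip[s sE] n4; apply: Alt_sub_of_linked.
apply: word_rel_total => [x|x y z|x i b]; first by left.
  exact: cycle3_linked_trans.
have [bx|] := eqVneq b (x i); first by left; rewrite bx upd_id.
rewrite -sE => /eqP->.
have s1 a : s a != a by rewrite eq_sym sE eqxx.
have ss : s * s = 1.
  by apply/permP=> a; apply/eqP; rewrite permM perm1 eq_sym !sE eqxx.
have cle (S : {set 'I_n}) : #|S| <= 3 -> exists k, k \notin S.
  by move=> S3; apply: exists_notin; rewrite card_ord (leq_ltn_trans S3).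
have [j ji] : exists j, j \notin [set i] by apply: cle; rewrite cards1.
have [k kij] : exists k, k \notin [set i; j].
  by apply: cle; rewrite cards2; case: (_ == _).
have [l lijk] : exists l, l \notin k |: [set i; j].
  by apply: cle; rewrite cardsU1 cards2; do 2!case: (~~ _).
move: ji kij lijk; rewrite !inE !negb_or => ji /andP[ki kj] /and3P[lk li lj].
(* A word moved by [g] agrees with [x] outside [i], [j], and one moved by [f] agrees with [x]
   outside [k], [l]; the four being distinct, only [x] is moved by both. Each map has n - 2
   controls, the most that [flip_in_G3] allows. *)
pose g := ctl i s (~: [set i; j]) x; pose f := ctl k s (~: [set k; l]) x.
have niS p q : p \notin ~: [set p; q] by rewrite !inE eqxx.
have agr S : agree S x x by apply/agreeP.
have gx : g x = upd x i (s (x i)) by rewrite ctlE // agr.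
have fx : f x = upd x k (s (x k)) by rewrite ctlE // agr.
have neq (y z : word A n) p : y p != z p -> y != z by apply: contra_neq => ->.
have cS2 (p q : 'I_n) : p != q -> #|~: [set p; q]|.+2 <= n.
  by move=> pq; rewrite -[leqRHS]card_ord -(cardsC [set p; q]) cards2 pq.
have fG : f \in G A n 3.
  by apply: flip_in_G3; rewrite ?cS2 // eq_sym.
have gG : g \in G A n 3.
  by apply: flip_in_G3; rewrite ?cS2 // eq_sym.
have ff : involutive f by move=> y; rewrite -permM -ctlM ss ctl1 perm1.
have gg : involutive g by move=> y; rewrite -permM -ctlM ss ctl1 perm1.
have fxx : f x != x by rewrite fx; apply: (neq _ _ k); rewrite upd_same.
have gxx : g x != x by rewrite gx; apply: (neq _ _ i); rewrite upd_same.
right; exists (f x); rewrite -gx; split; rewrite 1?eq_sym //.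
  rewrite gx fx; apply: (neq _ _ i); rewrite upd_same upd_other // eq_sym //.
rewrite -commutator_meeting_once ?groupM // => y yx.
have [/agreeP yf|/negPf yf] := boolP (agree (~: [set k; l]) y x); last first.
  by left; rewrite ctlE // yf.
have [/agreeP yg|/negPf yg] := boolP (agree (~: [set i; j]) y x); last first.
  by right; rewrite ctlE // yg.
case/eqP: yx; apply/ffunP=> p.
have [pkl|pkl] := boolP (p \in [set k; l]); last by rewrite yf // inE.
rewrite yg //; move: pkl; rewrite !inE => /orP[]/eqP->; rewrite negb_or.
  by rewrite ki.
by rewrite li.
Qed.
End Binary.

(** * The affine group over GF(2) and 2-ary instructions *)

Section AffineGroup.
Import GRing.Theory.
Local Open Scope ring_scope.

Lemma F2_cases (u : 'F_2) : u = 0 \/ u = 1.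
Proof. by case: u => [[|[|?]] ?] //; [left | right]; apply: val_inj. Qed.

Lemma F2_neq0 (u : 'F_2) : u != 0 -> u = 1.
Proof. by case: (F2_cases u) => ->; rewrite ?eqxx. Qed.

(** A transvection when [v 0 k = 0]. Multiplying by it on the right adds multiples of column [k] to
    the other columns. *)
Definition transv (n : nat) (k : 'I_n) (v : 'rV['F_2]_n) : 'M['F_2]_n :=
  1%:M + delta_mx k 0 *m v.

Lemma mul_transv (n : nat) (k : 'I_n) (v r : 'rV['F_2]_n) :
  r *m transv k v = r + r 0 k *: v.
Proof.
rewrite mulmxDr mulmx1 mulmxA -colE; congr (_ + _).
by rewrite [col k r]mx11_scalar mul_scalar_mx mxE.
Qed.

Lemma transvD (n : nat) (k : 'I_n) (v w : 'rV['F_2]_n) :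
  v 0 k = 0 -> transv k v *m transv k w = transv k (v + w).
Proof.
move=> vk; apply/row_matrixP=> j; rewrite !rowE mulmxA !mul_transv.
set r := delta_mx 0 j; have -> : (r + r 0 k *: v) 0 k = r 0 k.
  by rewrite [LHS]mxE [X in _ + X]mxE vk mulr0 addr0.
by rewrite scalerDr addrA.
Qed.

Lemma transv0 (n : nat) (k : 'I_n) : transv k 0 = 1%:M.
Proof. by rewrite /transv mulmx0 addr0. Qed.

Lemma transvNK (n : nat) (k : 'I_n) (v : 'rV['F_2]_n) :
  v 0 k = 0 -> transv k v *m transv k (- v) = 1%:M.
Proof. by move=> vk; rewrite transvD // subrr transv0. Qed.

Lemma transv_unit (n : nat) (k : 'I_n) (v : 'rV['F_2]_n) :
  v 0 k = 0 -> transv k v \in unitmx.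
Proof. by move=> /transvNK /mulmx1_unit[]. Qed.

Definition rowof (A : finType) (n : nat) (e : A -> 'F_2) (x : word A n) : 'rV['F_2]_n :=
  \row_i e (x i).

Lemma rowof_inj (A : finType) (n : nat) (e : A -> 'F_2) :
  injective e -> injective (@rowof A n e).
Proof.
move=> ie x y /rowP xy; apply/ffunP=> i; apply: ie.
by have := xy i; rewrite !mxE.
Qed.

Definition affine (A : finType) (n : nat) (e : A -> 'F_2) (f : {perm word A n})
    (M : 'M['F_2]_n) (b : 'rV['F_2]_n) : Prop :=
  forall x, rowof e (f x) = rowof e x *m M + b.

Lemma AffP (A : finType) (n : nat) (e : A -> 'F_2) (f : {perm word A n}) :
  reflect (exists M b, M \in unitmx /\ affine e f M b) (f \in Aff n e).
Proof.
rewrite inE; apply: (iffP existsP) => [[M /existsP[b /andP[uM /forallP H]]]|].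
  by exists M, b; split=> // x; apply/eqP; apply: H.
move=> [M [b [uM H]]]; exists M; apply/existsP; exists b; rewrite uM /=.
by apply/forallP=> x; apply/eqP; apply: H.
Qed.

Lemma affine_exists (A : finType) (n : nat) (e : A -> 'F_2) (M : 'M['F_2]_n) b :
  bijective e -> M \in unitmx -> exists f : {perm word A n}, affine e f M b.
Proof.
case=> e' eK e'K uM.
pose g (x : word A n) : word A n := [ffun i => e' ((rowof e x *m M + b) 0 i)].
have gE x : rowof e (g x) = rowof e x *m M + b.
  by apply/rowP=> i; rewrite mxE ffunE e'K.
have ig : injective g.
  move=> x y gxy; apply: (rowof_inj (can_inj eK)).
  apply: (can_inj (mulmxK uM)); apply: (addIr b).
  by rewrite -!gE gxy.
by exists (perm ig) => x; rewrite permE gE.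
Qed.

Lemma affine_uniq (A : finType) (n : nat) (e : A -> 'F_2) (f g : {perm word A n}) M b :
  injective e -> affine e f M b -> affine e g M b -> f = g.
Proof.
by move=> ie fA gA; apply/permP=> x; apply: (rowof_inj ie); rewrite fA gA.
Qed.

Lemma affineM (A : finType) (n : nat) (e : A -> 'F_2) (f g : {perm word A n}) M b N c :
  affine e f M b -> affine e g N c -> affine e (f * g)%g (M *m N) (b *m N + c).
Proof. by move=> fA gA x; rewrite permM gA fA mulmxDl mulmxA addrA. Qed.

Lemma Aff_group_set (A : finType) (n : nat) (e : A -> 'F_2) : group_set (@Aff A n e).
Proof.
apply/group_setP; split.
  apply/AffP; exists 1%:M, 0; split; first exact: unitmx1.
  by move=> x; rewrite perm1 mulmx1 addr0.
move=> f g /AffP[M [b [uM fA]]] /AffP[N [c [uN gA]]]; apply/AffP.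
by exists (M *m N), (b *m N + c); rewrite unitmx_mul uM uN; split=> //; apply: affineM.
Qed.

(** By injectivity, changing [x i] changes the new value at [i], so over GF(2) the difference of new
    and old value does not depend on [x i]. It is then a function of a single bit, and every such
    function is affine. *)
Lemma G2_sub_Aff (A : finType) (n : nat) (e : A -> 'F_2) :
  bijective e -> (2 <= n)%N -> G A n 2 \subset Aff n e.
Proof.
move=> [e' eK e'K] n2; have ie := can_inj eK.
rewrite -[Aff n e]/(gval (Group (Aff_group_set n e))) gen_subG.
apply/subsetP=> f; rewrite inE.
case/andP=> /existsP[i /forallP triv] /forallP/(_ i)/existsP[S /andP[Sl dep]].
have trivE j x : j != i -> f x j = x j.
  by move=> ji; have /forallP/(_ x)/eqP := implyP (triv j) ji.
have depE (x y : word A n) : {in S, x =1 y} -> f x i = f y i.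
  move=> xy; apply/eqP; have /forallP/(_ x)/forallP/(_ y)/implyP := dep.
  by apply; apply/eqfun_inP.
have fneq (x : word A n) c : c != x i -> f (upd x i c) i != f x i.
  move=> cx; apply: contra_neq cx => fi.
  have /perm_inj/ffunP/(_ i) : f (upd x i c) = f x.
    apply/ffunP=> j; have [->//|ji] := eqVneq j i.
    by rewrite !trivE // upd_other.
  by rewrite upd_same.
have iS : i \in S.
  apply: contraT => iS; pose x : word A n := [ffun=> e' 0].
  have /fneq/eqP[] : e' 1 != x i by rewrite ffunE (can_eq e'K).
  by apply: depE => j jS; rewrite upd_other //; apply: contraNneq iS => <-.
(* When the new value depends on [x i] alone, any other coordinate serves as [k]; one exists because
   [2 <= n]. *)
have [k ki Sk] : exists2 k, k != i & S \subset [set i; k].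
  have [S0|[k]] := set_0Vmem (S :\ i).
    have [|k] := @exists_notin _ [set i]; first by rewrite cards1 card_ord.
    rewrite inE => ki; exists k => //; rewrite -(setD1K iS) S0.
    by apply/subsetP=> j; rewrite !inE orbF => ->.
  rewrite !inE => /andP[ki kS]; exists k => //.
  suff -> : S = [set i; k] by [].
  apply/esym/eqP; rewrite eqEcard cards2 eq_sym ki Sl andbT.
  by apply/subsetP=> j; rewrite !inE => /orP[]/eqP->.
pose d (x : word A n) := e (f x i) - e (x i).
have dU x c : d (upd x i c) = d x.
  rewrite /d upd_same; have [->|cx] := eqVneq c (x i); first by rewrite upd_id.
  have := fneq _ _ cx; move: cx; rewrite -!(inj_eq ie).
  by case: (F2_cases (e c)) => ->; case: (F2_cases (e (x i))) => ->;
    case: (F2_cases (e (f x i))) => ->; case: (F2_cases (e (f (upd x i c) i))) => -> // _ _; apply/eqP.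
have dk (x y : word A n) : x k = y k -> d x = d y.
  move=> xy; rewrite -(dU x (y i)) /d upd_same; congr (e _ - _); apply: depE.
  move=> j /(subsetP Sk); rewrite !inE => /orP[]/eqP->; first by rewrite upd_same.
  by rewrite upd_other.
(* Interpolation of [d] in the bit [x k], with the constant words 0 and 1 as sample points. *)
pose be := d [ffun=> e' 0]; pose al := d [ffun=> e' 1] - be.
have dE (x : word A n) : d x = e (x k) * al + be.
  case: (F2_cases (e (x k))) => exk; rewrite exk ?mul0r ?mul1r ?add0r ?subrK.
    by apply: dk; rewrite ffunE -exk eK.
  by apply: dk; rewrite ffunE -exk eK.
apply/AffP; exists (transv k (al *: delta_mx 0 i)), (be *: delta_mx 0 i).
split; first by rewrite transv_unit // !mxE (negPf ki) mulr0.
move=> x; rewrite mul_transv -addrA scalerA -scalerDl; apply/rowP=> j.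
rewrite !mxE -dE eqxx /=; have [->|ji] := eqVneq j i.
  by rewrite mulr1 addrC subrK.
by rewrite trivE // mulr0 addr0.
Qed.

(** Stated for the pair of matrix and translation, so that elimination can be carried out on
    matrices. *)
Definition in_G2 (A : finType) (n : nat) (e : A -> 'F_2) M b : Prop :=
  exists2 f : {perm word A n}, f \in G A n 2 & affine e f M b.

Lemma in_G2M (A : finType) (n : nat) (e : A -> 'F_2) (M N : 'M['F_2]_n) b c :
  in_G2 e M b -> in_G2 e N c -> in_G2 e (M *m N) (b *m N + c).
Proof.
move=> [f fG fA] [g gG gA]; exists (f * g)%g; first exact: groupM.
exact: affineM.
Qed.

Lemma in_G2_1 (A : finType) (n : nat) (e : A -> 'F_2) : in_G2 e (1%:M : 'M_n) 0.
Proof. by exists 1%g => [|x]; rewrite ?group1 // perm1 mulmx1 addr0. Qed.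

(** Covers both kinds of generators: a linear [c] gives an elementary transvection, a constant [c] a
    translation along coordinate [i]. *)
Lemma in_G2_shear (A : finType) (n : nat) (e : A -> 'F_2) (M : 'M['F_2]_n) b
    (i k : 'I_n) (c : 'F_2 -> 'F_2) : bijective e -> M \in unitmx ->
  (forall r : 'rV_n, r *m M + b = r + c (r 0 k) *: delta_mx 0 i) -> in_G2 e M b.
Proof.
move=> be uM ME; have [f fA] := affine_exists b be uM; exists f => //.
have ie := bij_inj be.
have fE x j : e (f x j) = e (x j) + c (e (x k)) * (j == i)%:R.
  by have := fA x; rewrite ME => /rowP/(_ j); rewrite !mxE eqxx.
apply: mem_gen; rewrite inE; apply/andP; split.
  apply/existsP; exists i; apply/forallP=> j; apply/implyP=> /negPf ji.
  by apply/forallP=> x; apply/eqP/ie; rewrite fE ji mulr0 addr0.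
apply/forallP=> j; apply/existsP; exists [set j; k].
rewrite cards2 /=; apply/andP; split; first by case: (_ == _).
apply/forallP=> x; apply/forallP=> y; apply/implyP=> /eqfun_inP xy.
by apply/eqP/ie; rewrite !fE !xy ?inE ?eqxx ?orbT.
Qed.

Lemma in_G2_transv (A : finType) (n : nat) (e : A -> 'F_2) (k : 'I_n) (v : 'rV['F_2]_n) :
  bijective e -> v 0 k = 0 -> in_G2 e (transv k v) 0.
Proof.
move=> be vk.
(* The vanishing of [u 0 k] is carried through the sum because [transvD] requires it. *)
pose P (u : 'rV_n) := u 0 k = 0 /\ in_G2 e (transv k u) 0.
have P0 : P 0 by rewrite /P mxE transv0; split=> //; apply: in_G2_1.
suff [] : P v by [].
rewrite [v]row_sum_delta; apply: (big_ind P) => [|u w [uk uG] [wk wG]|j _] //.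
  split; first by rewrite mxE uk wk addr0.
  by have := in_G2M uG wG; rewrite mul0mx addr0 transvD.
have [->|jk] := eqVneq j k.
  by rewrite vk scale0r.
have vk0 : (v 0 j *: delta_mx 0 j : 'rV['F_2]_n) 0 k = 0.
  by rewrite !mxE eqxx eq_sym (negPf jk) mulr0.
split=> //; apply: (@in_G2_shear _ _ _ _ _ j k (fun a => a * v 0 j)) => //.
  exact: transv_unit.
by move=> r; rewrite mul_transv addr0 scalerA.
Qed.

Lemma in_G2_translation (A : finType) (n : nat) (e : A -> 'F_2) (b : 'rV['F_2]_n) :
  bijective e -> in_G2 e 1%:M b.
Proof.
move=> be; rewrite [b]row_sum_delta.
apply: (big_ind (in_G2 e 1%:M)) => [|u w uG wG|j _]; first exact: in_G2_1.
  by have := in_G2M uG wG; rewrite !mulmx1.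
apply: (@in_G2_shear _ _ _ _ _ j j (fun=> b 0 j)) => //; first exact: unitmx1.
by move=> r; rewrite mulmx1.
Qed.

Lemma in_G2_div (A : finType) (n : nat) (e : A -> 'F_2) (M : 'M['F_2]_n)
    (k : 'I_n) (v : 'rV['F_2]_n) : bijective e -> v 0 k = 0 ->
  in_G2 e (M *m transv k v) 0 -> in_G2 e M 0.
Proof.
move=> be vk MG.
have vNk : (- v) 0 k = 0 by rewrite mxE vk oppr0.
have := in_G2M MG (in_G2_transv be vNk).
by rewrite -mulmxA transvNK // mulmx1 mul0mx addr0.
Qed.

(** Gaussian elimination by column operations, from the last row upwards: [m] counts the rows not
    yet reduced. Reduced rows survive because they vanish in the column that is being added. *)
Lemma in_G2_unitmx (A : finType) (n : nat) (e : A -> 'F_2) (M : 'M['F_2]_n) :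
  bijective e -> M \in unitmx -> in_G2 e M 0.
Proof.
move=> be; suff H m : forall N : 'M['F_2]_n, N \in unitmx ->
    (forall j : 'I_n, (m <= j)%N -> row j N = delta_mx 0 j) -> in_G2 e N 0.
  by move=> uM; apply: (H n) => // j; rewrite leqNgt ltn_ord.
elim: m => [N _ N1|m IHm N uN Nm].
  suff -> : N = 1%:M by apply: in_G2_1.
  by apply/row_matrixP=> j; rewrite N1 // row1.
have [mn|nm] := ltnP m n; last first.
  by apply: IHm => // j mj; move: (leq_trans nm mj); rewrite leqNgt ltn_ord.
pose k := Ordinal mn.
have pivot (N' : 'M['F_2]_n) : N' \in unitmx ->
    (forall j : 'I_n, (m < j)%N -> row j N' = delta_mx 0 j) ->
    row k N' 0 k != 0 -> in_G2 e N' 0.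
  move=> uN' N'm /F2_neq0 N'k.
  (* Row [k] has entry 1 in column [k], so the transvection adds exactly [w] to it and turns it into
     a unit vector. *)
  pose w := delta_mx 0 k - row k N'.
  have wk : w 0 k = 0 by rewrite mxE [X in _ + X]mxE N'k mxE !eqxx subrr.
  apply: (in_G2_div be wk); apply: IHm.
    by rewrite unitmx_mul uN' transv_unit.
  move=> j; rewrite leq_eqVlt => /orP[/eqP jm|mj].
    have -> : j = k by apply: val_inj.
    by rewrite row_mul mul_transv N'k scale1r addrC subrK.
  rewrite row_mul mul_transv N'm // mxE eqxx (_ : (k == j) = false) ?scale0r ?addr0 //.
  by apply/eqP=> kj; rewrite -kj ltnn in mj.
have [Nk|Nk] := eqVneq (row k N 0 k) 0; last exact: pivot.
have [a am Na] : exists2 a : 'I_n, (a <= m)%N & row k N 0 a != 0.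
  case: (boolP [exists a : 'I_n, (a <= m)%N && (row k N 0 a != 0)]).
    by case/existsP=> a /andP[am Na]; exists a.
  rewrite negb_exists => /forallP N0.
  (* Otherwise row [k] is supported on indices beyond [m], where the rows of [N] are unit vectors,
     so [N] fixes it. As [N] also sends the [k]-th unit vector to this row, invertibility makes the
     two equal, against the zero pivot. *)
  have rN : row k N *m N = row k N.
    rewrite mulmx_sum_row [RHS]row_sum_delta; apply: eq_bigr => j _.
    have [jm|mj] := leqP j m; last by rewrite (Nm j mj).
    by have := N0 j; rewrite jm /= negbK => /eqP->; rewrite !scale0r.
  have := rN; rewrite [in RHS]rowE => /(can_inj (mulmxK uN)) rk.
  by move: Nk; rewrite rk !mxE !eqxx => /eqP; rewrite oner_eq0.
have ak : a != k by apply: contra_neq Na => ->.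
have dk : (delta_mx 0 k : 'rV['F_2]_n) 0 a = 0 by rewrite mxE (negPf ak) andbF.
(* Adding column [a] to column [k] makes the pivot nonzero; since [a <= m], the reduced rows have
   entry 0 in column [a]. *)
apply: (in_G2_div be dk); apply: pivot.
- by rewrite unitmx_mul uN transv_unit.
- move=> j mj; rewrite row_mul mul_transv Nm // mxE eqxx.
  rewrite (_ : (a == j) = false) ?scale0r ?addr0 //.
  by apply/eqP=> aj; rewrite -aj ltnNge am in mj.
by rewrite row_mul mul_transv mxE Nk add0r mxE [delta_mx _ _ _ _]mxE !eqxx mulr1.
Qed.

Lemma Aff_sub_G2 (A : finType) (n : nat) (e : A -> 'F_2) :
  bijective e -> Aff n e \subset G A n 2.
Proof.
move=> be; apply/subsetP=> f /AffP[M [b [uM fA]]].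
have := in_G2M (in_G2_unitmx be uM) (in_G2_translation b be).
rewrite mulmx1 mul0mx add0r => -[g gG gA].
by rewrite (affine_uniq (bij_inj be) fA gA).
Qed.
End AffineGroup.

(** * The four cases *)

Theorem theorem2 (A : finType) (n : nat) (hA : 2 <= #|A|) (hn : 2 <= n) :
  (* (i) *)
  G A n n = ('Sym_(word A n))%g
  (* (ii) *)
  /\ (#|A| = 2 ->
        (forall e : A -> 'F_2, bijective e -> G A n 2 = Aff n e)
        /\ (4 <= n -> G A n 3 = ('Alt_(word A n))%g /\ G A n n.-1 = ('Alt_(word A n))%g))
  (* (iii) *)
  /\ (3 <= n -> 3 <= #|A| -> odd #|A| ->
        G A n 2 = ('Sym_(word A n))%g /\ G A n n.-1 = ('Sym_(word A n))%g)
  (* (iv) *)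
  /\ (3 <= n -> 4 <= #|A| -> ~~ odd #|A| ->
        G A n 2 = ('Alt_(word A n))%g /\ G A n n.-1 = ('Alt_(word A n))%g).
Proof.
have eqG l (H : {group {perm word A n}}) :
    G A n l \subset H -> H \subset G A n l -> G A n l = H.
  by move=> GH HG; apply/eqP; rewrite eqEsubset GH.
have n1 : n.-1 < n by rewrite ltn_predL ltnW.
split; first by apply: eqG; rewrite ?subsetT ?Gn_Sym.
split=> [A2|].
  split=> [e be|n4].
    by apply/eqP; rewrite eqEsubset G2_sub_Aff // Aff_sub_G2.
  (* The two groups are squeezed: Alt is contained in [G A n 3], which lies in [G A n n.-1], which
     lies in Alt. The remaining cases use the same sandwich with [G A n 2]. *)
  have G3n : G A n 3 \subset G A n n.-1 by rewrite G_mono // -ltnS prednK // ltnW.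
  have GAlt : G A n n.-1 \subset ('Alt_(word A n))%g by rewrite G_sub_Alt // A2.
  have AltG := Alt_sub_G3 A2 n4.
  split; apply: eqG => //; first exact: subset_trans GAlt.
  exact: subset_trans G3n.
split=> n3 A3 parA;
  have G2n : G A n 2 \subset G A n n.-1 by rewrite G_mono // -ltnS prednK // ltnW.
  have SymG := Sym_sub_G2 A3 parA (ltnW hn).
  split; apply: eqG; rewrite ?subsetT //.
  exact: subset_trans G2n.
have GAlt : G A n n.-1 \subset ('Alt_(word A n))%g by rewrite G_sub_Alt.
have AltG := Alt_sub_G2 n (ltnW A3).
split; apply: eqG => //; first exact: subset_trans GAlt.
exact: subset_trans G2n.
Qed.
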